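(* The integrality gap of the spreading LP for the bounded version of $2$-dimAP+ is $\Omega(\sqrt{k})$; that is, there is an absolute constant $c>0$ and, for infinitely many values of $k$, instances of bounded $2$-dimAP+ with $k$ terminals whose optimal integral cost is at least $c\sqrt{k}$ times the optimal value of the spreading LP.
   Context: Bounded $2$-dimAP+: the input is a graph $G=(V,E)$ with $|V|=n$ ($\sqrt{n}$ an integer), nonnegative edge weights $w$, terminals $T\subseteq V$ with $|T|=k$, and an injective $f_0:T\to\{1,\ldots,\sqrt{n}\}^2$; a feasible solution is an injective $f:V\to\{1,\ldots,\sqrt{n}\}^2$ with $f|_T=f_0$, of cost $\sum_{\{u,v\}\in E}w_{uv}\|f(u)-f(v)\|_2$, to be minimized. The spreading LP has as variables a metric $d$ on $V$ and is: minimize $\sum_{\{u,v\}\in E}w_{uv}\,d(u,v)$ subject to $\sum_{v\in S}d(u,v)\geq (|S|-1)^{1+1/2}/4$ for all $S\subseteq V$ and $u\in S$, and $d(u,v)=\|f_0(u)-f_0(v)\|_2$ for all $u,v\in T$. The integrality gap is the supremum over instances of the ratio of the optimal integral cost to the optimal LP value. *)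

(* Defs.v *)
From HB Require Import structures.
From mathcomp Require Import all_boot all_order all_algebra.
From mathcomp Require Import all_classical all_reals all_analysis.

Set Implicit Arguments.
Unset Strict Implicit.
Unset Printing Implicit Defensive.

Import Order.TTheory GRing.Theory Num.Theory.

Local Open Scope classical_set_scope.
Local Open Scope ring_scope.

(* The s x s grid, with coordinates 0, ..., s-1 instead of 1, ..., s; only
   differences of coordinates are ever used. *)
Definition grid (s : nat) : finType := ('I_s * 'I_s)%type.

(* Spelled out because the library norm on matrices and products is the
   sup norm. *)
Definition euclid_dist (R : realType) (s : nat) (p q : grid s) : R :=
  Num.sqrt (((p.1 : nat)%:R - (q.1 : nat)%:R) ^+ 2 +
            ((p.2 : nat)%:R - (q.2 : nat)%:R) ^+ 2).

(* An instance of bounded 2-dimAP+, with side = sqrt n.  The values of [weight]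
   off the edges and of [preplaced] off the terminals are irrelevant. *)
Record instance (R : realType) := Instance {
  vertex : finType;
  side : nat;
  card_vertex : #|vertex| = (side ^ 2)%N;
  edge : rel vertex;
  edge_sym : symmetric edge;
  edge_irr : irreflexive edge;
  weight : vertex -> vertex -> R;
  weight_sym : forall u v, weight u v = weight v u;
  weight_ge0 : forall u v, edge u v -> 0 <= weight u v;
  terminal : {set vertex};
  preplaced : vertex -> grid side;
  preplaced_inj : {in terminal &, injective preplaced}
}.

Section Problem.
Variables (R : realType) (I : instance R).
Let V := vertex I.

(* [enum_rank] selects one of the two orientations of each edge. *)
Definition cost (d : V -> V -> R) : R :=
  \sum_(p : V * V | edge p.1 p.2 && (enum_rank p.1 < enum_rank p.2)%N)
    weight p.1 p.2 * d p.1 p.2.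

Definition placement (f : V -> grid (side I)) : Prop :=
  injective f /\ {in terminal I, f =1 @preplaced R I}.

Definition integral_opt : \bar R :=
  ereal_inf [set (cost (fun u v => euclid_dist R (f u) (f v)))%:E
            | f in [set f | placement f]].

Definition is_metric (d : V -> V -> R) : Prop :=
  [/\ forall u v, 0 <= d u v,
      forall u v, d u v = 0 <-> u = v,
      forall u v, d u v = d v u
    & forall u v w, d u w <= d u v + d v w].

Definition spreading (d : V -> V -> R) : Prop :=
  forall (S : {set V}) (u : V), u \in S ->
    (#|S|%:R - 1) `^ (1 + 1 / 2) / 4 <= \sum_(v in S) d u v.

Definition spreading_feasible (d : V -> V -> R) : Prop :=
  [/\ is_metric d,
      spreading d
    & forall u v, u \in terminal I -> v \in terminal I ->
        d u v = euclid_dist R (preplaced u) (preplaced v)].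

Definition spreading_opt : \bar R :=
  ereal_inf [set (cost d)%:E | d in [set d | spreading_feasible d]].

End Problem.

(* Instances with zero LP value are left out, their ratio being undefined:
   [spreading] gives d u v >= 1/4 for u != v, so the LP value is 0 only when
   all edge weights, and hence all integral costs, are 0. *)
Definition integrality_gap (R : realType) (k : nat) : \bar R :=
  ereal_sup [set r | exists I : instance R,
    [/\ #|terminal I| = k, (0 < spreading_opt I)%E
      & r = (integral_opt I / spreading_opt I)%E]].

(* Main.v *)
(* Preplace every vertex of the s x s grid at its own position except the corner
   z, and join z to the opposite corner c by the only edge.  The unique placement
   puts z at its own corner, at cost at least s - 1.  The LP may instead move z
   to c: pulling the Euclidean metric back along z |-> c and adding 1 between z
   and the other vertices gives a solution of cost 1.  Its spreading inequalities
   follow from the fact that a ball of integer radius j in the sup norm has at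
   most (2j+1)^2 grid points, so that summing min(d, r) over layers bounds the
   total distance of M points from below by M r - (4 r^3 - r)/3 + 1 for every
   r >= 1; taking r about 0.3 sqrt M yields M^(3/2)/4. *)

Require Import Defs.
From HB Require Import structures.
From mathcomp Require Import all_boot all_order all_algebra.
From mathcomp Require Import all_classical all_reals all_analysis.
From mathcomp Require Import zify ring lra.

Set Implicit Arguments.
Unset Strict Implicit.
Unset Printing Implicit Defensive.

Import Order.TTheory GRing.Theory Num.Theory.

Local Open Scope ring_scope.

(** * Distance sums from ball growth *)

(** Here [x] stands for the square root of the number of points and [r.+1] for the radius at which
    distances are cut off. *)
Lemma exists_layer_cutoff (R : realType) (x : R) : 0 <= x ->
  exists r : nat,
    x ^+ 3 / 4 <= x ^+ 2 * r.+1%:R - (4 * r.+1%:R ^+ 3 - r.+1%:R) / 3 + 1.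
Proof.
move=> x0; have [x4|x4] := leP x 4.
  (* With cutoff 1 the right-hand side is x^2, which is at least x^3/4 exactly because x <= 4. *)
  by exists 0; nra.
have y0 : 0 <= 3 / 10 * x by lra.
exists (Num.truncn (3 / 10 * x)).
have := truncn_itv y0.
move: (Num.truncn _) => n /andP[]; rewrite -[n.+1%:R]natr1.
move: (n%:R : R) => m m1 m2.
set y := m + 1.
have h1 : 3 / 10 * x <= y by rewrite /y; lra.
(* Since 1 < x/4, rounding up costs at most x/4 on top of 3x/10. *)
have h2 : y <= 55 / 100 * x by rewrite /y; lra.
have h3 : 0 <= (y - 3 / 10 * x) * (55 / 100 * x - y) by apply: mulr_ge0; lra.
(* The coefficient 85/100 makes the [x * y ^+ 2] terms of the product cancel. *)
have h4 : 0 <= (y - 3 / 10 * x) * (55 / 100 * x - y) * (y + 85 / 100 * x).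
  by apply: mulr_ge0 => //; lra.
have h5 : 0 <= x ^+ 2 * (y - 3 / 10 * x) by apply: mulr_ge0; [apply: sqr_ge0|lra].
have h6 : 0 <= x ^+ 3 by apply: exprn_ge0.
have : 0 <= y by lra.
move: h1 h2 h3 h4 h5; move: y => y *; lra.
Qed.

(** For d >= 1, the number of j in 1..r with d <= j is exactly r + 1 - min(d, r + 1). *)
Lemma leq_layers (d r : nat) :
  (0 < d)%N -> (r.+1 <= d + \sum_(j < r) (d <= j.+1))%N.
Proof.
move=> d0; elim: r => [|r IH]; first by rewrite big_ord0 addn0.
rewrite big_ord_recr /=; move: (\sum_(j < r) _)%N IH => a IH.
by case: (leqP d r.+1) => /= h; lia.
Qed.

(** The closed form of 1^2 + 3^2 + ... + (2r+1)^2, cleared of division; the isolated 1 is the first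
    square. *)
Lemma sum_odd_squares (r : nat) :
  (3 * (\sum_(j < r) (2 * j.+1 + 1) ^ 2 + 1) + r.+1 = 4 * r.+1 ^ 3)%N.
Proof.
elim: r => [|r IH]; first by rewrite big_ord0.
rewrite big_ord_recr /=; move: (\sum_(j < r) _)%N IH => a.
rewrite !expnS !expn0; lia.
Qed.

Lemma powR_three_halves (R : realType) (a : R) :
  0 <= a -> a `^ (1 + 1 / 2) = Num.sqrt a ^+ 3.
Proof.
move=> a0; rewrite -powR12_sqrt// -powR_mulrn ?powR_ge0// -powRrM.
by congr (_ `^ _); field.
Qed.

Lemma sum_ge_of_ball_card (R : realType) (T : finType) (A : {set T})
    (d : T -> nat) :
  (forall v, v \in A -> (0 < d v)%N) ->
  (forall j, (0 < j)%N ->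
     (#|[set v in A | (d v <= j)%N]| <= (2 * j + 1) ^ 2)%N) ->
  #|A|%:R `^ (1 + 1 / 2) / 4 <= \sum_(v in A) (d v)%:R :> R.
Proof.
move=> dpos dball; rewrite powR_three_halves// -natr_sum.
have [r] := exists_layer_cutoff (sqrtr_ge0 (#|A|%:R : R)).
rewrite sqr_sqrtr// => /le_trans; apply.
(* Sum the layer inequality over [A] and exchange the sums: each layer then counts the points of one
   ball. *)
have : (#|A| * r.+1 <=
        \sum_(v in A) d v + \sum_(j < r) (2 * j.+1 + 1) ^ 2)%N.
  apply: (@leq_trans (\sum_(v in A) (d v + \sum_(j < r) (d v <= j.+1)))%N).
    rewrite -sum_nat_const; apply: leq_sum => v vA.
    exact/leq_layers/dpos.
  rewrite big_split/= leq_add2l exchange_big/=; apply: leq_sum => j _.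
  apply: leq_trans (dball j.+1 isT).
  rewrite -sum1_card big_mkcond [leqRHS]big_mkcond/=.
  by apply: leq_sum => v _; rewrite inE; case: (v \in A); case: (d v <= _)%N.
have := sum_odd_squares r.
move: (\sum_(j < r) _)%N (\sum_(v in A) _)%N => a b /(congr1 (fun n => n%:R : R)).
rewrite -(ler_nat R) !(natrD, natrM, natrX) => ha hb; lra.
Qed.

(** * Balls in the grid *)

Lemma card_ord_ball (s j : nat) (u : nat) :
  (#|[set i : 'I_s | `|i - u|%N <= j]| <= 2 * j + 1)%N.
Proof.
(* The ball lies in an interval of 2j+1 integers starting at [u - j]; truncation of this difference
   at 0 only moves the interval right, still covering up to u + j. *)
rewrite cardE -(size_map val) -(size_iota (u - j) (2 * j + 1)).
apply: uniq_leq_size; first by rewrite map_inj_uniq ?enum_uniq//; exact: val_inj.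
move=> _ /mapP[i + ->]; rewrite mem_enum inE mem_iota /=; lia.
Qed.

(** Valued in [nat], so that distances can be counted by layers. *)
Definition sup_dist (s : nat) (p q : grid s) : nat :=
  maxn `|p.1 - q.1|%N `|p.2 - q.2|%N.

Lemma sup_dist_eq0 (s : nat) (p q : grid s) : (sup_dist p q == 0)%N = (p == q).
Proof.
case: p q => [p1 p2] [q1 q2]; rewrite xpair_eqE -!val_eqE /sup_dist /=; lia.
Qed.

Lemma card_sup_ball (s j : nat) (u : grid s) :
  (#|[set v | sup_dist u v <= j]| <= (2 * j + 1) ^ 2)%N.
Proof.
apply: (@leq_trans #|finset.setX [set i : 'I_s | `|i - u.1|%N <= j]%N
                          [set i : 'I_s | `|i - u.2|%N <= j]%N|).
  apply/subset_leq_card/fintype.subsetP => v; rewrite !inE /sup_dist geq_max.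
  by rewrite distnC [X in _ && (X <= _)%N]distnC.
by rewrite cardsX -mulnn; apply: leq_mul; exact: card_ord_ball.
Qed.

(** * The Euclidean metric on the grid *)

Section Euclid.
Variables (R : realType) (s : nat).
Implicit Types p q t : grid s.
Notation e := (@euclid_dist R s).

Lemma euclid_distC p q : e p q = e q p.
Proof. by rewrite /euclid_dist; congr Num.sqrt; ring. Qed.

Lemma euclid_dist_ge0 p q : 0 <= e p q.
Proof. exact: sqrtr_ge0. Qed.

Lemma distn_natr (m n : nat) : (`|m - n|%N)%:R = `|m%:R - n%:R| :> R.
Proof. by rewrite pmulrn abszE intr_norm rmorphB. Qed.

Lemma sup_dist_le_euclid p q : (sup_dist p q)%:R <= e p q.
Proof.
rewrite /sup_dist /euclid_dist; case: leqP => _; rewrite distn_natr -sqrtr_sqr;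
  by apply: ler_wsqrtr; rewrite ?lerDl ?lerDr sqr_ge0.
Qed.

Lemma euclid_dist_self p : e p p = 0.
Proof. by rewrite /euclid_dist !subrr expr0n addr0 sqrtr0. Qed.

Lemma euclid_dist_eq0 p q : e p q = 0 -> p = q.
Proof.
move=> e0; apply/eqP; rewrite -sup_dist_eq0 -leqn0 -(ler_nat R).
by apply: le_trans (sup_dist_le_euclid p q) _; rewrite e0.
Qed.

(** Squaring reduces this to Cauchy-Schwarz, which in the plane is (ad - bc)^2 >= 0. *)
Lemma minkowski2 (a b c d : R) :
  Num.sqrt ((a + c) ^+ 2 + (b + d) ^+ 2) <=
  Num.sqrt (a ^+ 2 + b ^+ 2) + Num.sqrt (c ^+ 2 + d ^+ 2).
Proof.
have P (x y : R) : 0 <= x ^+ 2 + y ^+ 2 by rewrite addr_ge0 ?sqr_ge0.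
rewrite -(ler_pXn2r (isT : (0 < 2)%N)) ?nnegrE ?addr_ge0 ?sqrtr_ge0//.
rewrite [leRHS]sqrrD !sqr_sqrtr//.
suff : a * c + b * d <= Num.sqrt (a ^+ 2 + b ^+ 2) * Num.sqrt (c ^+ 2 + d ^+ 2).
  by lra.
rewrite -sqrtrM//; apply: le_trans (ler_norm _) _.
rewrite -sqrtr_sqr; apply: ler_wsqrtr.
have : 0 <= (a * d - b * c) ^+ 2 by exact: sqr_ge0.
lra.
Qed.

Lemma euclid_dist_triangle p q t : e p t <= e p q + e q t.
Proof.
apply: le_trans (minkowski2 _ _ _ _).
by rewrite /euclid_dist !subrKA.
Qed.

End Euclid.

(** * The instance with one free corner *)

Section GapInstance.
Variables (R : realType) (m : nat).
Let s := m.+2.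
Let z : grid s := (ord0, ord0).
Let c : grid s := (ord_max, ord_max).

Definition corner_edge : rel (grid s) :=
  fun u v => (u == z) && (v == c) || (u == c) && (v == z).

Lemma corner_neq : z != c. Proof. by []. Qed.

Lemma corner_edge_sym : symmetric corner_edge.
Proof. by move=> u v; rewrite /corner_edge orbC andbC [X in _ || X]andbC. Qed.

Lemma corner_edge_irr : irreflexive corner_edge.
Proof.
move=> u; rewrite /corner_edge; case: eqP => [->|_] /=; first by [].
by rewrite andbF.
Qed.

Lemma card_grid : #|grid s| = (s ^ 2)%N.
Proof. by rewrite card_prod card_ord mulnn. Qed.

Definition gap_instance : instance R :=
  @Instance R (grid s) s card_grid corner_edge corner_edge_sym corner_edge_irr
    (fun _ _ => 1) (fun _ _ => erefl) (fun _ _ _ => ler01) [set~ z] id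
    (fun _ _ _ _ => id).

Lemma card_gap_terminal : #|terminal gap_instance| = (s ^ 2).-1.
Proof. by rewrite cardsC1 card_grid. Qed.

Lemma gap_cost (d : grid s -> grid s -> R) :
  (forall u v, d u v = d v u) -> @cost R gap_instance d = d z c.
Proof.
move=> dC; rewrite /cost /=.
(* Name the endpoints [a], [b] in the order of [enum_rank], so that the cost sum keeps exactly the
   pair (a, b); symmetry of [d] makes the order harmless. *)
wlog [a [b [ab abE dab]]] : / exists a b : grid s,
  [/\ (enum_rank a < enum_rank b)%N,
   corner_edge =2 (fun u v => (u == a) && (v == b) || (u == b) && (v == a))
   & d z c = d a b].
  apply; case: (ltngtP (enum_rank z) (enum_rank c)) => [h|h|h].
  - by exists z, c.
  - by exists c, z; split=> // u v; rewrite /corner_edge orbC.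
  - by move/val_inj/enum_rank_inj/eqP: h; rewrite (negbTE corner_neq).
rewrite (big_pred1 (a, b)) ?mul1r// => -[u v] /=.
rewrite abE xpair_eqE; case: (eqVneq u a) => [->|ua] /=.
  case: (eqVneq v b) => [->|vb] /=; first by rewrite ab.
  by case: (eqVneq a b) ab => [->|]//=; rewrite ltnn.
by apply/negP => /andP[/andP[/eqP-> /eqP->]]; rewrite ltnNge (ltnW ab).
Qed.

Lemma gap_integral_opt :
  @integral_opt R gap_instance = (@euclid_dist R s z c)%:E.
Proof.
have costE (f : grid s -> grid s) : @placement R gap_instance f ->
    @cost R gap_instance (fun u v => euclid_dist R (f u) (f v)) =
    euclid_dist R z c.
  move=> [f_inj f_pre]; rewrite gap_cost => [|u v]; last exact: euclid_distC.
  have fid v : v != z -> f v = v by move=> vz; apply: f_pre; rewrite !inE.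
  rewrite (fid c) ?(eq_sym c) ?corner_neq//; congr euclid_dist.
  case: (eqVneq (f z) z) => // fz.
  (* If [f z] differed from [z], it would be a fixed point, and injectivity applied to f (f z) = f z
     would give f z = z. *)
  by have /f_inj fzz := fid _ fz; rewrite fzz eqxx in fz.
rewrite /integral_opt -[RHS]ereal_inf1; congr ereal_inf.
apply/seteqP; split=> [_ [f fP <-]|_ ->] /=; first by rewrite costE.
have idP : @placement R gap_instance id by split=> // v.
by exists id => //; rewrite costE.
Qed.

Definition merge (u : grid s) : grid s := if u == z then c else u.

(** The exclusive or is the cut metric separating [z] from all other vertices. *)
Definition lp_dist (u v : grid s) : R :=
  euclid_dist R (merge u) (merge v) + ((u == z) (+) (v == z))%:R.

(** An integer minorant of [lp_dist], to which the layer count applies. *)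
Definition lp_sup_dist (u v : grid s) : nat :=
  sup_dist (merge u) (merge v) + ((u == z) (+) (v == z)).

Lemma lp_sup_dist_le u v : (lp_sup_dist u v)%:R <= lp_dist u v.
Proof. by rewrite natrD lerD2r sup_dist_le_euclid. Qed.

(** The only distinct points that [merge] identifies are [z] and [c], and the cut term separates
    them. *)
Lemma lp_sup_dist_gt0 u v : u != v -> (0 < lp_sup_dist u v)%N.
Proof.
rewrite lt0n addn_eq0 sup_dist_eq0 /merge eqb0; apply: contra.
by case: (eqVneq u z) => [->|_]; case: (eqVneq v z) => _; rewrite ?andbF ?andbT.
Qed.

Lemma lp_dist_metric : @is_metric R gap_instance lp_dist.
Proof.
split=> [u v|u v|u v|u v w].
- by rewrite addr_ge0 ?euclid_dist_ge0.
- split=> [d0|->]; last by rewrite /lp_dist addbb euclid_dist_self addr0.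
  apply/eqP; apply: contraT => /lp_sup_dist_gt0; rewrite -(ltr_nat R).
  by move/lt_le_trans/(_ (lp_sup_dist_le u v)); rewrite d0 ltxx.
- by rewrite /lp_dist euclid_distC addbC.
- rewrite /lp_dist addrACA lerD ?euclid_dist_triangle//.
  by rewrite -natrD ler_nat; do 3 case: (_ == z).
Qed.

Lemma card_lp_ball (u : grid s) (j : nat) : (0 < j)%N ->
  (#|[set v in [set~ u] | (lp_sup_dist u v <= j)%N]| <= (2 * j + 1) ^ 2)%N.
Proof.
move=> j0; apply: leq_trans (card_sup_ball j (merge u)).
(* Sending z to u, which is not in the punctured ball, injects it into a ball of
   the plain grid. *)
pose f v := if v == z then u else v.
rewrite -(@card_in_imset _ _ f); last first.
  move=> v w; rewrite !inE /f => /andP[vu _] /andP[wu _].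
  case: eqP => [->|_]; case: eqP => [->|_] // h.
    by rewrite h eqxx in wu.
  by rewrite h eqxx in vu.
apply/subset_leq_card/fintype.subsetP => _ /imsetP[v + ->].
rewrite !inE /f /lp_sup_dist /merge => /andP[vu].
case: (eqVneq v z) vu => [->|vz] vu.
  by rewrite eq_sym (negbTE vu) => _; rewrite (eqP (_ : sup_dist u u == 0)) ?sup_dist_eq0.
by apply: leq_trans; rewrite leq_addr.
Qed.

Lemma lp_dist_spreading : @spreading R gap_instance lp_dist.
Proof.
move=> S u uS; have -> : #|S|%:R - 1 = #|S :\ u|%:R :> R.
  by rewrite (cardsD1 u S) uS natrD addrAC subrr add0r.
apply: (@le_trans _ _ (\sum_(v in S :\ u) (lp_sup_dist u v)%:R)).
  apply: sum_ge_of_ball_card => [v|j j0].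
    by rewrite !inE eq_sym => /andP[/lp_sup_dist_gt0].
  apply: leq_trans (card_lp_ball u j0); apply/subset_leq_card/fintype.subsetP.
  by move=> v; rewrite !inE -andbA => /and3P[-> _ ->].
rewrite (big_setD1 u uS)/= -[leLHS]add0r lerD//.
  by case: lp_dist_metric.
by apply: ler_sum => v _; exact: lp_sup_dist_le.
Qed.

Lemma lp_dist_feasible : @spreading_feasible R gap_instance lp_dist.
Proof.
split; [exact: lp_dist_metric|exact: lp_dist_spreading|move=> u v].
rewrite /= !inE /lp_dist /merge => /negbTE-> /negbTE->.
by rewrite addbb addr0.
Qed.

Lemma gap_spreading_opt_le1 : (@spreading_opt R gap_instance <= 1)%E.
Proof.
apply: ereal_inf_lbound; exists lp_dist; first exact: lp_dist_feasible.
rewrite gap_cost; last by case: lp_dist_metric.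
by rewrite /lp_dist /merge eqxx (eq_sym c) (negbTE corner_neq) euclid_dist_self add0r.
Qed.

(** The spreading inequality for the pair {z, c} alone forces d(z, c) >= 1/4. *)
Lemma gap_spreading_opt_gt0 : (0 < @spreading_opt R gap_instance)%E.
Proof.
apply: (@lt_le_trans _ _ (1 / 4)%:E); first by rewrite lte_fin; lra.
apply: le_ereal_inf_tmp => _ [d [[_ d0 dC _] dS _] <-].
rewrite lee_fin gap_cost//.
have := dS [set z; c] z; rewrite !inE eqxx => /(_ isT).
rewrite cards2 corner_neq big_setU1 ?inE ?corner_neq//= big_set1.
rewrite (proj2 (d0 z z) erefl) add0r.
have -> : 2%:R - 1 = 1 :> R by ring.
by rewrite powR1.
Qed.

End GapInstance.

Theorem theorem9 (R : realType) :
  exists c : R, 0 < c /\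
    forall K : nat, exists k : nat,
      [/\ (K <= k)%N,
          ((c * Num.sqrt k%:R)%:E <= integrality_gap R k)%E
        & exists I : instance R,
            [/\ #|terminal I| = k,
                (0 < spreading_opt I)%E
              & ((c * Num.sqrt k%:R)%:E * spreading_opt I <= integral_opt I)%E]].
Proof.
exists (1 / 2); split; first by lra.
move=> K; exists (K.+2 ^ 2).-1.
set k := (K.+2 ^ 2).-1.
have opt_gt0 := gap_spreading_opt_gt0 R K.
have opt_le1 := gap_spreading_opt_le1 R K.
have cardT : #|terminal (gap_instance R K)| = k := card_gap_terminal R K.
(* The constant 1/2 comes from sqrt k <= K + 2 <= 2(K + 1), where K + 1 is the sup distance between
   the two corners. *)
have ratio : (1 / 2) * Num.sqrt k%:R <= K.+1%:R :> R.
  have : Num.sqrt k%:R <= K.+2%:R :> R.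
    rewrite -[leRHS]ger0_norm// -sqrtr_sqr ler_wsqrtr// -natrX ler_nat.
    exact: leq_pred.
  rewrite -[K.+2%:R]natr1 -[K.+1%:R]natr1; have : (0 : R) <= K%:R by []; lra.
have int_ge : (((1 / 2) * Num.sqrt k%:R)%:E <= integral_opt (gap_instance R K))%E.
  rewrite gap_integral_opt lee_fin (le_trans ratio)//.
  apply: le_trans (sup_dist_le_euclid _ _ _).
  by rewrite ler_nat /sup_dist /=; lia.
have coef_ge0 : (0 <= ((1 / 2) * Num.sqrt k%:R : R)%:E)%E.
  by rewrite lee_fin mulr_ge0 ?sqrtr_ge0//; lra.
have gap : ((1 / 2 * Num.sqrt k%:R)%:E * spreading_opt (gap_instance R K) <=
            integral_opt (gap_instance R K))%E.
  apply: le_trans int_ge; rewrite -[leRHS]mule1.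
  exact: lee_wpmul2l.
split; last by exists (gap_instance R K).
  by rewrite /k; nia.
apply: (@le_trans _ _ (integral_opt (gap_instance R K) /
                       spreading_opt (gap_instance R K))%E).
  (* Division in the extended reals behaves as in the reals here, because the LP value lies between
     0 and 1. *)
  have fin_opt : spreading_opt (gap_instance R K) \is a fin_num.
    by rewrite ge0_fin_numE ?(le_lt_trans opt_le1) ?ltry// ltW.
  move: fin_opt opt_gt0 gap => /fineK <-; rewrite lte_fin => o0 gap.
  by rewrite inver gt_eqF// lee_pdivlMr.
by apply: ereal_sup_ubound; exists (gap_instance R K).
Qed.
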